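(* Let $G$ be a finite group, let $S$ be a subset of $G$ with $|S|=d$, and let $\sigma$ be an anti-automorphism of $G$. (1) If the twisted Cayley graph $C(G,S)^\sigma$ is connected and undirected and $|G|\geq 4$, then the nontrivial spectrum of its normalised adjacency operator lies in the interval $$\left(-1+\frac{h_\sigma^4}{2^{12}d^8},\ 1-\frac{h_\sigma^2}{2d^2}\right],$$ where $h_\sigma$ denotes the vertex Cheeger constant of $C(G,S)^\sigma$. (2) Suppose $\sigma^2$ is the trivial automorphism of $G$. If the twisted Cayley sum graph $C_\Sigma(G,S)^\sigma$ is connected and undirected and $|G|\geq 4$, then the nontrivial spectrum of its normalised adjacency operator lies in the interval $$\left(-1+\frac{h_{\Sigma,\sigma}^4}{2^{12}d^8},\ 1-\frac{h_{\Sigma,\sigma}^2}{2d^2}\right],$$ where $h_{\Sigma,\sigma}$ denotes the vertex Cheeger constant of $C_\Sigma(G,S)^\sigma$. (3) Suppose $\sigma^{2k}$ is the trivial automorphism of $G$, where $k\geq1$ is an odd integer. If the twisted Cayley sum graph $C_\Sigma(G,S)^\sigma$ is connected and undirected and $|G|\geq 4$, then the nontrivial spectrum of its normalised adjacency operator lies in the interval $$\left(\left(-1+\frac{1}{2^{12}d^{8k}}\left(\frac12\left(1-\left(1-\frac{h_{\Sigma,\sigma}^2}{2d^2}\right)^k\right)\right)^4\right)^{1/k},\ 1-\frac{h_{\Sigma,\sigma}^2}{2d^2}\right],$$ where $h_{\Sigma,\sigma}$ denotes the vertex Cheeger constant of $C_\Sigma(G,S)^\sigma$ and $x^{1/k}$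 denotes the real $k$-th root of the real number $x$.
   Context: An anti-automorphism of $G$ is a bijection $\sigma:G\to G$ with $\sigma(ab)=\sigma(b)\sigma(a)$ for all $a,b\in G$. The twisted Cayley graph $C(G,S)^\sigma$ has vertex set $G$, and there is an edge from $x$ to $y$ if and only if $y=\sigma(xs)$ for some $s\in S$. The twisted Cayley sum graph $C_\Sigma(G,S)^\sigma$ has vertex set $G$, and there is an edge from $x$ to $y$ if and only if $y=\sigma(x^{-1}s)$ for some $s\in S$. Loops are allowed. Such a graph is called undirected if its edge relation is symmetric. When undirected, it is $d$-regular with $d=|S|$ (a loop at a vertex counts once towards its degree). The normalised adjacency operator of a $d$-regular graph on vertex set $V$ is $\frac1d$ times its adjacency matrix. The nontrivial spectrum of the normalised adjacency operator is the set of its eigenvalues other than $1$ and $-1$. For a subset $V_1$ of the vertex set $V$, $N(V_1)$ is the set of vertices adjacent to some element of $V_1$, and $\partial(V_1)=N(V_1)\setminus V_1$. The vertex Cheeger constant is $$h=\inf\left\{\frac{|\partial(V_1)|}{|V_1|} : \emptyset\neq V_1\subseteq V,\ |V_1|\leq \frac{|V|}{2}\right\}.$$ *)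

(* Defs.v *)
From mathcomp Require Import all_boot all_order all_algebra all_fingroup.
From mathcomp Require Import boolp classical_sets reals exp.

Set Implicit Arguments.
Unset Strict Implicit.
Unset Printing Implicit Defensive.

Import Order.TTheory GRing.Theory Num.Theory.
Local Open Scope ring_scope.

Definition anti_automorphism (gT : finGroupType) (sigma : gT -> gT) : Prop :=
  bijective sigma /\ forall a b : gT, sigma (a * b)%g = (sigma b * sigma a)%g.

Definition twisted_cayley (gT : finGroupType) (S : {set gT})
    (sigma : gT -> gT) : rel gT :=
  fun x y => [exists s in S, y == sigma (x * s)%g].

Definition twisted_cayley_sum (gT : finGroupType) (S : {set gT})
    (sigma : gT -> gT) : rel gT :=
  fun x y => [exists s in S, y == sigma (x^-1 * s)%g].

Definition undirected (T : finType) (e : rel T) : Prop := symmetric e.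

Definition graph_connected (T : finType) (e : rel T) : Prop :=
  forall x y : T, connect e x y.

(* Vertices are indexed by 'I_#|T| through enum_val; the spectrum does not
   depend on this enumeration. *)
Definition adjacency_mx (R : realType) (T : finType) (e : rel T) : 'M[R]_#|T| :=
  \matrix_(i, j) (e (enum_val i) (enum_val j))%:R.

Definition normalised_adjacency_mx (R : realType) (d : nat) (T : finType)
    (e : rel T) : 'M[R]_#|T| :=
  d%:R^-1 *: adjacency_mx R e.

Definition nontrivial_spectrum (R : realType) (d : nat) (T : finType)
    (e : rel T) : {pred R} :=
  [pred l : R | [&& eigenvalue (normalised_adjacency_mx R d e) l,
                    l != 1 & l != -1]].
Arguments nontrivial_spectrum R d {T} e.

Definition nbhd (T : finType) (e : rel T) (A : {set T}) : {set T} :=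
  [set y : T | [exists x in A, e x y]]%SET.

Definition vertex_boundary (T : finType) (e : rel T) (A : {set T}) : {set T} :=
  nbhd e A :\: A.

Definition vertex_cheeger (R : realType) (T : finType) (e : rel T) : R :=
  inf [set r : R | exists A : {set T},
    [/\ A != finset.set0,
        #|A|%:R <= #|T|%:R / 2 :> R &
        r = #|vertex_boundary e A|%:R / #|A|%:R]]%classic.

(* For odd k, the unique real y with y ^+ k = x (see real_rootK). The sign is
   split off because powR is not the real root at negative arguments. *)
Definition real_root (R : realType) (k : nat) (x : R) : R :=
  Num.sg x * powR `|x| k%:R^-1.

Lemma real_rootK (R : realType) (k : nat) (x : R) :
  odd k -> real_root k x ^+ k = x.
Proof.
move=> ko; have k0 : (0 < k)%N by case: k ko.
rewrite /real_root exprMn -(@powR_mulrn R (`|x| `^ _)) ?powR_ge0 // -powRrM mulVf; last first.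
  by rewrite pnatr_eq0 -lt0n.
rewrite powRr1 // [RHS]numEsg; congr (_ * _).
case: sgrP => _; first by rewrite expr0n gtn_eqF.
- by rewrite expr1n.
- by rewrite -signr_odd ko expr1.
Qed.

(* Main.v *)
Require Import Defs.
From mathcomp Require Import all_boot all_order all_algebra all_fingroup.
From mathcomp Require Import boolp classical_sets reals exp.
From mathcomp Require Import ring lra zify finset.

Set Implicit Arguments.
Unset Strict Implicit.
Unset Printing Implicit Defensive.

Import Order.TTheory GRing.Theory Num.Theory.
Local Open Scope ring_scope.

(** Write T for the normalised adjacency operator, g = h^2 / (2 d^2) and
   1 + l for the distance of an eigenvalue l to -1.  All three parts follow
   from one dichotomy for an eigenvalue l other than 1 and -1: l <= 1 - g, and
   either 1 + l >= g / 128 or 1 + l >= 2 / d.  Both lower bounds are far above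
   the required ones.

   The upper bound is the discrete Cheeger inequality.  A set A with at most
   half of the vertices has at least h |A| outgoing edges; peeling off level
   sets gives an L^1 inequality (edge_variation), and applying it to squares
   of functions yields a Poincare inequality (poincare): the total squared
   deviation of any f from its mean is at most d / h^2 times its edge energy.

   For the lower bound, let u be an eigenfunction for l.  Since
   | |a| - |b| | <= |a + b|, the energy of |u| is proportional to 1 + l, so by
   Poincare |u| is nearly constant when 1 + l < g / 128
   (eigenfunction_abs_flat).  If u and w were orthogonal eigenfunctions, scaled
   to have mean square 1, then |u| and |w| would be close to 1, and |u + w| and
   |u - w| close to sqrt 2, at most vertices.  This is absurd because
   |u + w| + |u - w| = 2 max (|u|, |w|).  Hence the eigenspace is a line
   (no_orthogonal_eigenfunctions).

   The group enters through right translations.  A right translation of the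
   end points of all edges is compensated by a permutation of their starting
   points, a left translation for the Cayley graph and a right one for the sum
   graph.  As the graph is undirected, T^2 therefore commutes with every right
   translation (eigenfunction_sqr_isotopy).  The eigenspace of T^2 for l^2 is
   that of T for l, because -l lies strictly between 1 - g and 1 and so is not
   an eigenvalue.  The line spanned by u is thus invariant under right
   translations, which forces u to be constant up to sign.  Then
   d (1 + l) is a sum of d terms equal to 0 or 2; it is positive, so it is at
   least 2 (eigenvalue_lower_gap).

   For the bound with k-th roots, the case 1 + l >= g / 128 is transported to
   k-th powers by convexity (contraction_exp). *)

(** * Medians *)

Lemma exists_median (R : realType) (T : finType) (f : T -> R) (x0 : T) :
  exists m : R, #|[set x | f x < m]|%:R <= #|T|%:R / 2 :> R /\
                #|[set x | m < f x]|%:R <= #|T|%:R / 2 :> R.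
Proof.
have half (A : {set T}) : (2 * #|A| <= #|T|)%N -> #|A|%:R <= #|T|%:R / 2 :> R.
  by rewrite -(ler_nat R) natrM => ?; lra.
pose P x := (2 * #|[set y | (f y < f x)%R]| <= #|T|)%N.
have [a _ amin] := arg_minP f (isT : xpredT x0).
have Pa : P a.
  rewrite /P (_ : [set y | _] = set0) ?cards0 //.
  by apply/setP => y; rewrite !inE ltNge amin.
have [b Pb bmax] := arg_maxP f Pa.
(* [b] has the largest value with at most half of the vertices below it. *)
exists (f b); split; first exact: half.
have [->|/set0Pn[c cA]] := eqVneq [set x | f b < f x] set0.
  by rewrite cards0 divr_ge0.
have [c' c'A cmin] := arg_minP f cA; have bc : f b < f c'.
  by have : c' \in [set x | f b < f x] by []; rewrite inE.
apply: half; have : ~~ P c'.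
  by apply: contraL bc => /bmax; rewrite -leNgt.
rewrite /P -ltnNge => lt.
have <- : ~: [set y | f y < f c'] = [set x | f b < f x].
  apply/setP => y; rewrite !inE -leNgt; apply/idP/idP => [|yb].
    exact: lt_le_trans.
  by apply: cmin; change (y \in [set x | f b < f x]); rewrite inE.
have := cardsC [set y | f y < f c']; lia.
Qed.

(** * Sums over directed edges *)

Section EdgeSums.
Variables (R : realType) (T : finType) (e : rel T) (d : nat).
Hypothesis esym : symmetric e.
Hypothesis ereg : forall x, #|[set y | e x y]| = d.

Implicit Types (f u : T -> R) (F G : T -> T -> R) (A : {set T}).

Definition edge_sum F : R := \sum_x \sum_(y | e x y) F x y.

Lemma eq_edge_sum F G :
  (forall x y, e x y -> F x y = G x y) -> edge_sum F = edge_sum G.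
Proof. by move=> FG; apply: eq_bigr => x _; apply: eq_bigr => y; apply: FG. Qed.

Lemma ler_edge_sum F G :
  (forall x y, e x y -> F x y <= G x y) -> edge_sum F <= edge_sum G.
Proof. by move=> FG; apply: ler_sum => x _; apply: ler_sum => y; apply: FG. Qed.

Lemma edge_sumD F G :
  edge_sum (fun x y => F x y + G x y) = edge_sum F + edge_sum G.
Proof. by rewrite -big_split; apply: eq_bigr => x _; rewrite big_split. Qed.

Lemma edge_sumZ c F : edge_sum (fun x y => c * F x y) = c * edge_sum F.
Proof. by rewrite mulr_sumr; apply: eq_bigr => x _; rewrite mulr_sumr. Qed.

Lemma edge_sumC F : edge_sum (fun x y => F y x) = edge_sum F.
Proof.
rewrite /edge_sum (exchange_big_dep xpredT) //=.
by apply: eq_bigr => x _; apply: eq_bigl => y; rewrite esym.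
Qed.

Lemma edge_sum_fst f : edge_sum (fun x _ => f x) = d%:R * \sum_x f x.
Proof.
rewrite mulr_sumr; apply: eq_bigr => x _.
rewrite big_const iter_addr_0 -(ereg x) mulr_natl; congr (_ *+ _).
by apply: eq_card => y; rewrite inE.
Qed.

Lemma edge_sum_snd f : edge_sum (fun _ y => f y) = d%:R * \sum_x f x.
Proof. by rewrite -edge_sum_fst -(edge_sumC (fun x _ => f x)). Qed.

(** Each boundary vertex is the end of at least one edge leaving [A]; an edge
   across the cut is met once in each direction, hence the factor 2. *)
Lemma edge_sum_cut A :
  2 * #|vertex_boundary e A|%:R <=
    edge_sum (fun x y => ((x \in A) != (y \in A))%:R).
Proof.
pose F x y : R := ((x \in A) && (y \notin A))%:R.
have -> : edge_sum (fun x y => ((x \in A) != (y \in A))%:R) =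
    edge_sum (fun x y => F x y + F y x).
  apply: eq_edge_sum => x y _; rewrite /F.
  by case: (x \in A); case: (y \in A); rewrite /= ?addr0 ?add0r.
suff: #|vertex_boundary e A|%:R <= edge_sum F.
  by rewrite edge_sumD (edge_sumC F); lra.
rewrite -(edge_sumC F) -sum1_card natr_sum big_mkcond /=.
apply: ler_sum => y _; case: ifP => [|_]; last first.
  by apply: sumr_ge0 => x _; rewrite ler0n.
rewrite !inE => /andP[yA /existsP[x /andP[xA exy]]].
rewrite (bigD1 x) /=; last by rewrite esym.
by rewrite /F xA yA lerDl; apply: sumr_ge0 => z _; rewrite ler0n.
Qed.

(** * The Cheeger and Poincare inequalities *)

Variable h : R.
Hypothesis h_gt0 : 0 < h.
Hypothesis expand : forall A, A != set0 ->
  #|A|%:R <= #|T|%:R / 2 :> R -> h * #|A|%:R <= #|vertex_boundary e A|%:R.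

(** Discrete co-area inequality: lowering [f] on its support by its least
   positive value removes a multiple of the cut of that support from the
   variation, and the support gets smaller. *)
Lemma edge_variation f :
  (forall x, 0 <= f x) ->
  #|[set x | 0 < f x]|%:R <= #|T|%:R / 2 :> R ->
  2 * h * \sum_x f x <= edge_sum (fun x y => `|f x - f y|).
Proof.
move: {2}_.+1 (ltnSn #|[set x | 0 < f x]|) => m.
elim: m f => // m IHm f; rewrite ltnS => lef f_ge0 small.
set A := [set x | 0 < f x] in lef small.
have fA x : x \notin A -> f x = 0.
  rewrite in_set -leNgt => fx; by apply/eqP; rewrite eq_le fx f_ge0.
have [A0|/set0Pn[x0 x0A]] := eqVneq A set0.
  rewrite big1 ?mulr0 => [|x _]; last by rewrite fA // A0 in_set0.
  by apply: sumr_ge0 => x _; apply: sumr_ge0.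
have [a aA0 amin] := arg_minP f x0A; have aA : a \in A by [].
clear aA0.
set c := f a in amin; have c_gt0 : 0 < c by move: aA; rewrite in_set.
pose f' x := f x - c * (x \in A)%:R.
have f'_ge0 x : 0 <= f' x.
  rewrite /f'; case xA: (x \in A); rewrite ?mulr0 ?subr0 //.
  by rewrite mulr1 subr_ge0 amin.
set B := [set x | 0 < f' x].
have sub : B \subset A :\ a.
  apply/fintype.subsetP => x; rewrite in_set => fx; rewrite in_setD1.
  apply/andP; split.
    by apply: contraTneq fx => ->; rewrite /f' aA mulr1 subrr ltxx.
  apply: contraTT fx => xA.
  by rewrite /f' (negbTE xA) mulr0 subr0 (fA _ xA) ltxx.
have cardA : #|A| = #|A :\ a|.+1 by rewrite (cardsD1 a) aA.
have /IHm : (#|B| < m)%N.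
  by apply: leq_ltn_trans (subset_leq_card sub) _; rewrite -cardA.
have small' : #|B|%:R <= #|T|%:R / 2 :> R.
  apply: le_trans small; rewrite ler_nat cardA.
  exact: leq_trans (subset_leq_card sub) (leqnSn _).
move=> /(_ f'_ge0 small') IH.
have -> : edge_sum (fun x y => `|f x - f y|) =
   edge_sum (fun x y => `|f' x - f' y| + c * ((x \in A) != (y \in A))%:R).
  apply: eq_edge_sum => x y _.
  have := f'_ge0 x; have := f'_ge0 y; rewrite /f'.
  case xA: (x \in A); case yA: (y \in A); rewrite /= ?mulr0 ?mulr1 ?subr0 ?addr0.
  - by move=> _ _; congr `|_|; ring.
  - move=> _ fx; rewrite (fA y) ?yA // !subr0 !ger0_norm ?subrK //.
  - move=> fy _; rewrite (fA x) ?xA // !sub0r !normrN !ger0_norm ?subrK //.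
  - by [].
rewrite edge_sumD edge_sumZ.
have sumE : \sum_x f x = \sum_x f' x + c * #|A|%:R.
  have -> : #|A|%:R = \sum_x (x \in A)%:R :> R.
    rewrite -sum1_card natr_sum big_mkcond /=.
    by apply: eq_bigr => x _; case: (x \in A).
  by rewrite mulr_sumr -big_split; apply: eq_bigr => x _; rewrite /= subrK.
have cut := edge_sum_cut A.
have A0 : A != set0 by apply/set0Pn; exists a.
have hA := expand A0 small.
have : c * (2 * (h * #|A|%:R)) <=
       c * edge_sum (fun x y => ((x \in A) != (y \in A))%:R).
  by rewrite ler_pM2l //; apply: le_trans cut; rewrite ler_pM2l.
rewrite sumE; lra.
Qed.

Hypothesis d_gt0 : (0 < d)%N.

Let dR_gt0 : 0 < d%:R :> R. Proof. by rewrite ltr0n. Qed.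

(** Each undirected edge contributes twice to the energy. *)
Definition energy f : R := edge_sum (fun x y => (f x - f y) ^+ 2).

(** The co-area inequality for [f ^ 2], where the variation
   [|a^2 - b^2| = |a - b| |a + b|] is split between the energy and the norm of
   [f] by a weighted mean inequality. *)
Lemma energy_supported f :
  (forall x, 0 <= f x) ->
  #|[set x | 0 < f x]|%:R <= #|T|%:R / 2 :> R ->
  h ^+ 2 * \sum_x f x ^+ 2 <= d%:R * energy f.
Proof.
move=> f_ge0 small.
have supp : [set x | 0 < f x ^+ 2] = [set x | 0 < f x].
  by apply/setP => x; rewrite !inE exprn_even_gt0 //= lt0r f_ge0 andbT.
have := @edge_variation (fun x => f x ^+ 2) (fun x => sqr_ge0 _).
rewrite supp => /(_ small) var.
set s := \sum_x f x ^+ 2 in var *.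
(* The weights 2 d and h make the norm absorb exactly half of the variation. *)
have : edge_sum (fun x y => (4 * d%:R * h) * `|f x ^+ 2 - f y ^+ 2|) <=
    edge_sum (fun x y => (4 * d%:R ^+ 2) * (f x - f y) ^+ 2 +
      (2 * h ^+ 2) * (f x ^+ 2 + f y ^+ 2)).
  apply: ler_edge_sum => x y _.
  set a := f x; set b := f y; set D := d%:R : R.
  have := sqr_ge0 (2 * D * (a - b) - h * (a + b)).
  have := sqr_ge0 (2 * D * (a - b) + h * (a + b)).
  have := sqr_ge0 (h * (a - b)).
  by case: (ger0P (a ^+ 2 - b ^+ 2)) => _; lra.
rewrite edge_sumD !edge_sumZ edge_sumD edge_sum_fst edge_sum_snd -/s -/(energy f).
set V := edge_sum _ in var *; set E := energy f => le.
have le1 : 4 * d%:R * h * (2 * h * s) <= 4 * d%:R * h * V.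
  by rewrite ler_pM2l // !mulr_gt0.
rewrite -(ler_pM2l (_ : 0 < 4 * d%:R)) ?mulr_gt0 //.
lra.
Qed.

(** Cutting [f] at a median leaves positive and negative parts whose supports
   have at most half of the vertices.  Their energies add up to at most that
   of [f], and the mean minimises the squared deviation. *)
Lemma poincare f :
  h ^+ 2 * (\sum_x f x ^+ 2 - (\sum_x f x) ^+ 2 / #|T|%:R) <= d%:R * energy f.
Proof.
have [x0 _|T0] := pickP T; last first.
  by rewrite /energy /edge_sum !big_pred0 // expr0n /= mul0r subrr !mulr0.
have n_gt0 : 0 < #|T|%:R :> R by rewrite ltr0n; apply/card_gt0P; exists x0.
have [m [small_lt small_gt]] := exists_median f x0.
pose p x := Num.max (f x - m) 0; pose q x := Num.max (m - f x) 0.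
have p_ge0 x : 0 <= p x by rewrite le_max lexx orbT.
have q_ge0 x : 0 <= q x by rewrite le_max lexx orbT.
have supp_p : [set x | 0 < p x] = [set x | m < f x].
  by apply/setP => x; rewrite !inE lt_max ltxx orbF subr_gt0.
have supp_q : [set x | 0 < q x] = [set x | f x < m].
  by apply/setP => x; rewrite !inE lt_max ltxx orbF subr_gt0.
have := @energy_supported p p_ge0; rewrite supp_p => /(_ small_gt) Ep.
have := @energy_supported q q_ge0; rewrite supp_q => /(_ small_lt) Eq.
have split_energy : energy p + energy q <= energy f.
  rewrite -edge_sumD; apply: ler_edge_sum => x y _; rewrite /p /q.
  by case: (lerP (f x - m) 0); case: (lerP (m - f x) 0);
     case: (lerP (f y - m) 0); case: (lerP (m - f y) 0); nra.
have split_norm : \sum_x (f x - m) ^+ 2 = \sum_x p x ^+ 2 + \sum_x q x ^+ 2.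
  rewrite -big_split; apply: eq_bigr => x _; rewrite /p /q /=.
  by case: (lerP (f x - m) 0); case: (lerP (m - f x) 0) => *; nra.
have mean : \sum_x f x ^+ 2 - (\sum_x f x) ^+ 2 / #|T|%:R <=
    \sum_x (f x - m) ^+ 2.
  set s := \sum_x f x; set n := #|T|%:R : R.
  have -> : \sum_x (f x - m) ^+ 2 = \sum_x f x ^+ 2 - 2 * m * s + n * m ^+ 2.
    rewrite /n /s -sum1_card natr_sum mulr_suml mulr_sumr -sumrB -big_split /=.
    by apply: eq_bigr => x _; ring.
  rewrite -subr_ge0.
  suff -> : forall a, a - 2 * m * s + n * m ^+ 2 - (a - s ^+ 2 / n) =
      (s - n * m) ^+ 2 / n by rewrite divr_ge0 ?sqr_ge0 ?ltW.
  by move=> a; field; rewrite gt_eqF.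
apply: le_trans (ler_wpM2l (sqr_ge0 h) mean) _.
rewrite split_norm mulrDr; apply: le_trans (lerD Ep Eq) _.
by rewrite -mulrDr ler_pM2l.
Qed.

(** * Eigenfunctions *)

Definition eigenfunction (l : R) u :=
  forall x, \sum_(y | e x y) u y = d%:R * l * u x.

Lemma sum_sqr_gt0 u x : u x != 0 -> 0 < \sum_x u x ^+ 2.
Proof.
move=> ux; rewrite (bigD1 x) //= ltr_pwDl ?exprn_even_gt0 //.
by apply: sumr_ge0 => y _; apply: sqr_ge0.
Qed.

Lemma sum_sqr_le0 u : \sum_x u x ^+ 2 <= 0 -> forall x, u x = 0.
Proof.
move=> u0 x; apply/eqP; apply: contraTT u0 => /sum_sqr_gt0.
by rewrite -ltNge.
Qed.

Lemma eigenfunctionZ l c u :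
  eigenfunction l u -> eigenfunction l (fun x => c * u x).
Proof. by move=> eu x; rewrite -mulr_sumr eu; ring. Qed.

Lemma eigenfunctionD l u w :
  eigenfunction l u -> eigenfunction l w -> eigenfunction l (fun x => u x + w x).
Proof. by move=> eu ew x; rewrite big_split /= eu ew; ring. Qed.

Lemma eigenfunctionB l u w :
  eigenfunction l u -> eigenfunction l w -> eigenfunction l (fun x => u x - w x).
Proof. by move=> eu ew x; rewrite sumrB eu ew; ring. Qed.

Lemma edge_sumM_eigen l u : eigenfunction l u ->
  edge_sum (fun x y => u x * u y) = d%:R * l * \sum_x u x ^+ 2.
Proof.
move=> eu; rewrite mulr_sumr; apply: eq_bigr => x _.
by rewrite -mulr_sumr eu; ring.
Qed.

Lemma edge_sum_sqr_eigen c l u : eigenfunction l u ->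
  edge_sum (fun x y => (u x + c * u y) ^+ 2) =
    d%:R * (1 + c ^+ 2 + 2 * c * l) * \sum_x u x ^+ 2.
Proof.
move=> eu.
have -> : edge_sum (fun x y => (u x + c * u y) ^+ 2) =
    edge_sum (fun x y => (u x ^+ 2 + c ^+ 2 * u y ^+ 2) + (2 * c) * (u x * u y)).
  by apply: eq_edge_sum => x y _; ring.
rewrite !edge_sumD !edge_sumZ (edge_sumM_eigen eu).
by rewrite (edge_sum_fst (fun x => u x ^+ 2)) (edge_sum_snd (fun x => u x ^+ 2)); ring.
Qed.

Lemma eigenfunction_sum0 l u : eigenfunction l u -> l != 1 -> \sum_x u x = 0.
Proof.
move=> eu l1; have := edge_sum_snd u; rewrite /edge_sum (eq_bigr _ (fun x _ => eu x)).
rewrite -mulr_sumr -mulrA => /(mulfI (lt0r_neq0 dR_gt0)) => lu.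
have /eqP : (l - 1) * \sum_x u x = 0 by rewrite mulrBl mul1r lu subrr.
by rewrite mulf_eq0 subr_eq0 (negbTE l1) => /eqP.
Qed.

Lemma eigenvalue_le l u : eigenfunction l u -> 0 < \sum_x u x ^+ 2 -> l != 1 ->
  h ^+ 2 <= 2 * d%:R ^+ 2 * (1 - l).
Proof.
move=> eu u0 l1; have := poincare u.
rewrite (eigenfunction_sum0 eu l1) expr0n /= mul0r subr0.
have -> : energy u = edge_sum (fun x y => (u x + -1 * u y) ^+ 2).
  by apply: eq_edge_sum => x y _; rewrite mulN1r.
rewrite (edge_sum_sqr_eigen _ eu) => le; rewrite -(ler_pM2r u0); lra.
Qed.

Lemma eigenvalue_geN1 l u :
  eigenfunction l u -> 0 < \sum_x u x ^+ 2 -> -1 <= l.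
Proof.
move=> eu u0; have : 0 <= edge_sum (fun x y => (u x + 1 * u y) ^+ 2).
  by apply: sumr_ge0 => x _; apply: sumr_ge0 => y _; apply: sqr_ge0.
rewrite (edge_sum_sqr_eigen _ eu) -mulrA pmulr_rge0 // pmulr_lge0 //; lra.
Qed.

(** The edge sum of [(u x + u y) ^ 2] is proportional to [1 + l] and dominates
   the energy of [|u|], so the Poincare inequality bounds the deviation of
   [|u|] from its mean [m]. *)
Lemma eigenfunction_abs_flat l u :
  eigenfunction l u -> 256 * d%:R ^+ 2 * (1 + l) < h ^+ 2 ->
  exists m : R, [/\ 0 <= m, #|T|%:R * m ^+ 2 <= \sum_x u x ^+ 2,
    127 / 128 * (\sum_x u x ^+ 2) <= #|T|%:R * m ^+ 2 &
    \sum_x (`|u x| - m) ^+ 2 <= (\sum_x u x ^+ 2) / 128].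
Proof.
move=> eu hl; set N := \sum_x u x ^+ 2; set n := #|T|%:R : R.
have [x0 _|T0] := pickP T; last first.
  by exists 0; rewrite /N !big_pred0 // expr0n !mulr0 mul0r; split.
have n_gt0 : 0 < n by rewrite ltr0n; apply/card_gt0P; exists x0.
have N_ge0 : 0 <= N by apply: sumr_ge0 => x _; apply: sqr_ge0.
have := poincare (fun x => `|u x|).
have -> : \sum_x `|u x| ^+ 2 = N by apply: eq_bigr => x _; rewrite real_normK ?num_real.
set s := \sum_x `|u x|; set m := s / n => poin.
have dev : \sum_x (`|u x| - m) ^+ 2 = N - n * m ^+ 2.
  have -> : \sum_x (`|u x| - m) ^+ 2 = N - 2 * m * s + n * m ^+ 2.
    rewrite /n /s /N -sum1_card natr_sum mulr_suml mulr_sumr -sumrB -big_split /=.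
    by apply: eq_bigr => x _; rewrite sqrrB real_normK ?num_real //; ring.
  by rewrite /m; field; rewrite gt_eqF.
have sn : s ^+ 2 / n = n * m ^+ 2 by rewrite /m; field; rewrite gt_eqF.
have energy_le : energy (fun x => `|u x|) <= 2 * d%:R * (1 + l) * N.
  have <- : edge_sum (fun x y => (u x + 1 * u y) ^+ 2) = 2 * d%:R * (1 + l) * N.
    by rewrite (edge_sum_sqr_eigen _ eu) -/N; ring.
  apply: ler_edge_sum => x y _; rewrite mul1r.
  by case: (ger0P (u x)); case: (ger0P (u y)); nra.
have near : N - n * m ^+ 2 <= N / 128.
  rewrite -(ler_pM2l (exprn_gt0 2 h_gt0)).
  rewrite sn in poin; apply: le_trans poin _.
  apply: le_trans (ler_wpM2l (ltW dR_gt0) energy_le) _.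
  have := ler_wpM2r N_ge0 (ltW hl); lra.
exists m; split.
- by rewrite divr_ge0 ?sumr_ge0 // ltW.
- by rewrite -subr_ge0 -dev; apply: sumr_ge0 => x _; apply: sqr_ge0.
- by rewrite -/N; lra.
- by rewrite dev.
Qed.

(** Since [|a + b| + |a - b| = 2 max (|a|, |b|)], these four absolute values
   cannot be close to numbers [r], [s], [P], [Q] with [r + s > 2 max (P, Q)]. *)
Lemma four_abs_spread (P Q r s a b : R) :
  P <= 1 -> Q <= 1 -> 14 / 10 <= r -> 14 / 10 <= s ->
  1 / 10 <= (`|a| - P) ^+ 2 + (`|b| - Q) ^+ 2 +
            ((`|a + b| - r) ^+ 2 + (`|a - b| - s) ^+ 2).
Proof.
move=> P1 Q1 r1 s1.
set al := `|a| - P; set be := `|b| - Q.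
set ga := `|a + b| - r; set de := `|a - b| - s.
have key (z : R) : 8 / 10 <= 2 * z - ga - de -> 1 / 10 <= z ^+ 2 + (ga ^+ 2 + de ^+ 2).
  move=> hz; have := sqr_ge0 (z + 2 * ga); have := sqr_ge0 (z + 2 * de).
  have := sqr_ge0 (ga - de); have : (8 / 10) ^+ 2 <= (2 * z - ga - de) ^+ 2.
    by apply: lerXn2r; rewrite ?nnegrE //; lra.
  lra.
have : 8 / 10 <= 2 * al - ga - de \/ 8 / 10 <= 2 * be - ga - de.
  rewrite /al /be /ga /de.
  case: (lerP `|b| `|a|) => ab; [left|right]; move: ab;
  by case: (ger0P a); case: (ger0P b); case: (ger0P (a + b));
     case: (ger0P (a - b)); lra.
have := sqr_ge0 al; have := sqr_ge0 be.
by move=> b2 a2 [/key|/key]; lra.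
Qed.

(** Near -1 an eigenspace is at most a line: [|u|] is nearly constant for every
   [u] in it, which fails for [a], [b], [a + b] or [a - b] when [a] and [b] are
   orthogonal of equal norm. *)
Lemma no_orthogonal_eigenfunctions l u w :
  eigenfunction l u -> eigenfunction l w -> \sum_x u x * w x = 0 ->
  0 < \sum_x u x ^+ 2 -> 0 < \sum_x w x ^+ 2 ->
  h ^+ 2 <= 256 * d%:R ^+ 2 * (1 + l).
Proof.
move=> eu ew orth u0 w0; rewrite leNgt; apply/negP => hl.
have [x0 _|T0] := pickP T; last by move: u0; rewrite big_pred0 // ltxx.
set n := #|T|%:R : R.
have n_gt0 : 0 < n by rewrite ltr0n; apply/card_gt0P; exists x0.
pose normalize (v : T -> R) x : R := Num.sqrt (n / \sum_x v x ^+ 2) * v x.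
have normE v : 0 < \sum_x v x ^+ 2 -> \sum_x (normalize v x) ^+ 2 = n.
  move=> v0; have -> : \sum_x (normalize v x) ^+ 2 = n / (\sum_x v x ^+ 2) * \sum_x v x ^+ 2.
    rewrite mulr_sumr; apply: eq_bigr => x _.
    by rewrite exprMn sqr_sqrtr // divr_ge0 ?ltW.
  by rewrite divfK ?gt_eqF.
pose a := normalize u; pose b := normalize w.
have ea : eigenfunction l a by apply: eigenfunctionZ.
have eb : eigenfunction l b by apply: eigenfunctionZ.
have ab0 : \sum_x a x * b x = 0.
  transitivity (Num.sqrt (n / \sum_x u x ^+ 2) * Num.sqrt (n / \sum_x w x ^+ 2) *
                \sum_x u x * w x); last by rewrite orth mulr0.
  by rewrite mulr_sumr; apply: eq_bigr => x _; rewrite /a /b /normalize; ring.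
have aa : \sum_x a x ^+ 2 = n by apply: normE.
have bb : \sum_x b x ^+ 2 = n by apply: normE.
have ab_sq c : c ^+ 2 = 1 -> \sum_x (a x + c * b x) ^+ 2 = 2 * n.
  move=> c1; have -> : \sum_x (a x + c * b x) ^+ 2 =
      \sum_x a x ^+ 2 + \sum_x b x ^+ 2 + 2 * c * \sum_x a x * b x.
    rewrite mulr_sumr -!big_split; apply: eq_bigr => x _ /=.
    have -> : (a x + c * b x) ^+ 2 =
        a x ^+ 2 + c ^+ 2 * b x ^+ 2 + 2 * c * (a x * b x) by ring.
    by rewrite c1 mul1r.
  by rewrite ab0 aa bb; ring.
have eD : eigenfunction l (fun x => a x + b x) by apply: eigenfunctionD.
have eB : eigenfunction l (fun x => a x - b x) by apply: eigenfunctionB.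
have DD : \sum_x (a x + b x) ^+ 2 = 2 * n.
  rewrite -(ab_sq 1) ?expr1n //.
  by apply: eq_bigr => x _; rewrite mul1r.
have BB : \sum_x (a x - b x) ^+ 2 = 2 * n.
  rewrite -(ab_sq (-1)) ?sqrrN ?expr1n //.
  by apply: eq_bigr => x _; rewrite mulN1r.
have [P [P0 PN _ dP]] := eigenfunction_abs_flat ea hl.
have [Q [Q0 QN _ dQ]] := eigenfunction_abs_flat eb hl.
have [r [r0 _ rN dr]] := eigenfunction_abs_flat eD hl.
have [s [s0 _ sN ds]] := eigenfunction_abs_flat eB hl.
rewrite aa -/n in PN dP; rewrite bb -/n in QN dQ.
rewrite DD -/n in rN dr; rewrite BB -/n in sN ds.
have le1 z : 0 <= z -> n * z ^+ 2 <= n -> z <= 1.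
  by move=> z0; rewrite ger_pMr // expr_le1.
have ge14 z : 0 <= z -> 127 / 128 * (2 * n) <= n * z ^+ 2 -> 14 / 10 <= z.
  move=> z0 nz; have : 127 / 128 * 2 <= z ^+ 2 by rewrite -(ler_pM2l n_gt0); lra.
  by rewrite leNgt => z2; rewrite leNgt; apply: contraNN z2 => z14; nra.
have : n * (1 / 10) <=
    \sum_x (`|a x| - P) ^+ 2 + \sum_x (`|b x| - Q) ^+ 2 +
    (\sum_x (`|a x + b x| - r) ^+ 2 + \sum_x (`|a x - b x| - s) ^+ 2).
  rewrite /n -sum1_card natr_sum mulr_suml -!big_split; apply: ler_sum => x _ /=.
  by rewrite mul1r four_abs_spread ?le1 ?ge14.
lra.
Qed.

(** Composition with [q] becomes composition with [p] under the adjacency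
   operator, and conversely by symmetry, so it commutes with the square of that
   operator.  Hence [z = T (u \o q) - l (u \o q)] satisfies [T z = - l z]. *)
Lemma eigenfunction_sqr_isotopy p q l u :
  bijective p -> bijective q -> (forall x y, e (p x) (q y) = e x y) ->
  eigenfunction l u ->
  (forall z, eigenfunction (- l) z -> forall x, z x = 0) ->
  eigenfunction l (u \o q).
Proof.
move=> pbij qbij iso eu noN.
have sum_q (v : T -> R) x : \sum_(y | e x y) v (q y) = \sum_(y | e (p x) y) v y.
  rewrite [RHS](reindex q) /=; last exact: onW_bij.
  by apply: eq_bigl => y; rewrite iso.
have sum_p (v : T -> R) x : \sum_(y | e x y) v (p y) = \sum_(y | e (q x) y) v y.
  rewrite [RHS](reindex p) /=; last exact: onW_bij.
  by apply: eq_bigl => y; rewrite (esym (q x)) iso.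
move=> x; rewrite sum_q eu /=; apply/eqP; rewrite -subr_eq0; apply/eqP.
have := noN (fun x => d%:R * l * u (p x) - d%:R * l * u (q x)); apply => {}x.
rewrite sumrB -!mulr_sumr sum_p sum_q !eu; ring.
Qed.

(** If [1 + l] is small, the eigenspace is a line stable under a transitive
   family of isotopies, so that [u] is [u x0] up to sign everywhere.  Summing
   over the neighbours of [x0] then shows that [d (1 + l)] is an even
   integer. *)
Lemma eigenvalue_lower_gap x0 l u :
  (forall x, exists p q, [/\ bijective p, bijective q,
     forall y z, e (p y) (q z) = e y z & q x0 = x]) ->
  eigenfunction l u -> 0 < \sum_x u x ^+ 2 -> l != 1 -> l != -1 ->
  h ^+ 2 <= 256 * d%:R ^+ 2 * (1 + l) \/ 2 <= d%:R * (1 + l).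
Proof.
move=> trans eu u0 l1 lN1.
have l_gtN1 : 0 < 1 + l.
  by have := eigenvalue_geN1 eu u0; rewrite le_eqVlt eq_sym (negbTE lN1) /=; lra.
have [|hl] := leP (h ^+ 2) (256 * d%:R ^+ 2 * (1 + l)); [by left|right].
have noN z : eigenfunction (- l) z -> forall x, z x = 0.
  move=> ez; apply: sum_sqr_le0; rewrite leNgt; apply/negP => z0.
  have := eigenvalue_le ez z0; rewrite eqr_oppLR lN1 => /(_ isT).
  have : 0 < d%:R ^+ 2 * (1 + l) by rewrite mulr_gt0 ?exprn_gt0.
  lra.
have pm x : u x = u x0 \/ u x = - u x0.
  have [p [q [pbij qbij iso <-]]] := trans x.
  have ew := eigenfunction_sqr_isotopy pbij qbij iso eu noN.
  have ww : \sum_x (u \o q) x ^+ 2 = \sum_x u x ^+ 2.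
    by rewrite [RHS](reindex q) //; apply: onW_bij.
  (* Equal norms make the difference and the sum of the two orthogonal. *)
  have orth : \sum_x (u x - (u \o q) x) * (u x + (u \o q) x) = 0.
    transitivity (\sum_x u x ^+ 2 - \sum_x (u \o q) x ^+ 2).
      by rewrite -sumrB; apply: eq_bigr => y _; rewrite subr_sqr.
    by rewrite ww subrr.
  have := no_orthogonal_eigenfunctions (eigenfunctionB eu ew) (eigenfunctionD eu ew) orth.
  have [/sum_sqr_le0 B0 _|B0 /(_ isT)] := leP (\sum_x (u x - (u \o q) x) ^+ 2) 0.
    by left; have /eqP := B0 x0; rewrite subr_eq0 => /eqP.
  have [/sum_sqr_le0 D0 _|D0 /(_ isT)] := leP (\sum_x (u x + (u \o q) x) ^+ 2) 0.
    by right; have /eqP := D0 x0; rewrite addrC addr_eq0 => /eqP.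
  by rewrite leNgt hl.
have ux0 : u x0 != 0.
  apply: contraTneq u0 => u00; rewrite -leNgt big1 // => x _.
  by case: (pm x) => ->; rewrite u00 ?oppr0 expr0n.
pose t y := 1 + u y / u x0.
have t02 y : t y = 2 \/ t y = 0.
  by rewrite /t; case: (pm y) => ->; [left|right]; rewrite ?mulNr divff // subrr.
have t_ge0 y : 0 <= t y by case: (t02 y) => ->.
have sum_t : \sum_(y | e x0 y) t y = d%:R * (1 + l).
  rewrite big_split /= -mulr_suml eu mulfK // mulrDr mulr1; congr (_ + _).
  by rewrite -(ereg x0) -sum1_card natr_sum; apply: eq_bigl => y; rewrite inE.
rewrite -sum_t.
have [/existsP[y /andP[ey /eqP ty]]|no] := boolP [exists y, e x0 y && (t y == 2)].
  by rewrite (bigD1 y) //= ty lerDl sumr_ge0.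
have : 0 < d%:R * (1 + l) by rewrite mulr_gt0.
rewrite -sum_t big1 ?ltxx // => y ey; case: (t02 y) => // ty.
by case/negP: no; apply/existsP; exists y; rewrite ey ty eqxx.
Qed.

End EdgeSums.

(** * The vertex Cheeger constant *)

Section Cheeger.
Variables (R : realType) (T : finType) (e : rel T).
Local Notation h := (vertex_cheeger R e).

Lemma vertex_cheeger_expand (A : {set T}) : A != set0 ->
  #|A|%:R <= #|T|%:R / 2 :> R -> h * #|A|%:R <= #|vertex_boundary e A|%:R.
Proof.
move=> A0 small; rewrite -ler_pdivlMr; last by rewrite ltr0n card_gt0.
apply: ge_inf; last by exists A.
by exists 0 => _ [B [_ _ ->]]; rewrite divr_ge0.
Qed.

Hypothesis T2 : (2 <= #|T|)%N.

Let half1 (x : T) : #|[set x]|%:R <= #|T|%:R / 2 :> R.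
Proof. by rewrite cards1; move: T2; rewrite -(ler_nat R); lra. Qed.

Let point : exists x : T, True.
Proof. by have /card_gt0P[x _] := ltnW T2; exists x. Qed.

(** Connectedness makes every boundary in question nonempty, so all the ratios
   are at least [2 / #|T|]. *)
Lemma vertex_cheeger_gt0 : symmetric e -> graph_connected e -> 0 < h.
Proof.
move=> esym econn; have [x0 _] := point.
have n_gt0 : 0 < #|T|%:R :> R by rewrite ltr0n ltnW.
apply: (@lt_le_trans _ _ (2 / #|T|%:R)); first by rewrite divr_gt0.
apply: lb_le_inf.
  exists (#|vertex_boundary e [set x0]|%:R / #|[set x0]|%:R), [set x0].
  by split=> //; apply/set0Pn; exists x0; rewrite inE.
move=> _ [A [A0 small ->]].
have A_gt0 : 0 < #|A|%:R :> R by rewrite ltr0n card_gt0.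
have boundary : (0 < #|vertex_boundary e A|)%N.
  rewrite card_gt0; apply/negP => /eqP noB.
  have cl : closed e (mem A).
    apply: (intro_closed (sym_connect_sym esym)) => x y exy xA; apply: contraT => yA.
    suff : y \in vertex_boundary e A by rewrite noB inE.
    by rewrite !inE yA; apply/existsP; exists x; rewrite xA.
  have [x xA] := set0Pn _ A0.
  have : A = setT.
    by apply/setP => y; rewrite inE -(closed_connect cl (econn x y)).
  by move=> AT; move: small; rewrite AT cardsT; lra.
rewrite ler_pdivlMr // mulrAC ler_pdivrMr //.
have : 1 <= #|vertex_boundary e A|%:R :> R by rewrite ler1n.
nra.
Qed.

Lemma vertex_cheeger_le d :
  (forall x, #|[set y | e x y]| = d) -> h <= d%:R.
Proof.
move=> ereg; have [x _] := point.
have := @vertex_cheeger_expand [set x]; rewrite half1 cards1 mulr1.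
have -> : [set x] != set0 by apply/set0Pn; exists x; rewrite inE.
move=> /(_ isT isT) /le_trans; apply; rewrite ler_nat -(ereg x).
apply: subset_leq_card; apply/fintype.subsetP => y; rewrite !inE => /andP[_].
by case/existsP => z; rewrite inE => /andP[/eqP ->].
Qed.

End Cheeger.

(** * The spectrum of an isotopy-transitive graph *)

Lemma eigenvalue_eigenfunction (R : realType) (T : finType) (e : rel T) d (l : R) :
  symmetric e -> (0 < d)%N -> eigenvalue (normalised_adjacency_mx R d e) l ->
  exists2 u : T -> R, eigenfunction e d l u & 0 < \sum_x u x ^+ 2.
Proof.
move=> esym d_gt0 /eigenvalueP[v vA /rV0Pn[i vi]].
exists (fun x => v 0 (enum_rank x)) => [x|].
  have /rowP/(_ (enum_rank x)) := vA; rewrite !mxE -mulrA => <-.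
  rewrite mulr_sumr (reindex (@enum_val T T)) /=; last exact: onW_bij (enum_val_bij T).
  rewrite big_mkcond; apply: eq_bigr => j _; rewrite !mxE enum_rankK enum_valK esym.
  have d0 : d%:R != 0 :> R by rewrite pnatr_eq0 -lt0n.
  by case: (e _ _); rewrite ?mulr0 // mulr1 mulrCA mulfV ?mulr1.
by apply: (@sum_sqr_gt0 _ _ _ (enum_val i)); rewrite enum_valK.
Qed.

(** The pairs [(p, q)] need not be automorphisms: [p] acts on starting points
   and [q] on end points of edges.  This covers twisted graphs, on which
   translations do not act by automorphisms. *)
Theorem isotopic_spectrum (R : realType) (T : finType) (e : rel T) d x0 (l : R) :
  (2 <= #|T|)%N -> symmetric e -> graph_connected e ->
  (forall x, #|[set y | e x y]| = d) ->
  (forall x, exists p q, [/\ bijective p, bijective q,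
     forall y z, e (p y) (q z) = e y z & q x0 = x]) ->
  l \in nontrivial_spectrum R d e ->
  let h := vertex_cheeger R e in
  [/\ 0 < h, h <= d%:R, h ^+ 2 <= 2 * d%:R ^+ 2 * (1 - l) &
      h ^+ 2 <= 256 * d%:R ^+ 2 * (1 + l) \/ 2 <= d%:R * (1 + l)].
Proof.
move=> T2 esym econn ereg iso; rewrite inE => /and3P[ev l1 lN1] h.
have h_gt0 : 0 < h by apply: vertex_cheeger_gt0.
have h_le : h <= d%:R by apply: vertex_cheeger_le.
have d_gt0 : (0 < d)%N by rewrite -(ltr0n R); apply: lt_le_trans h_le.
have [u eu u0] := eigenvalue_eigenfunction esym d_gt0 ev.
have expand := @vertex_cheeger_expand R T e.
split=> //; first exact: (eigenvalue_le esym ereg h_gt0 expand d_gt0 eu).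
exact: (eigenvalue_lower_gap esym ereg h_gt0 expand d_gt0 iso eu).
Qed.

(** * Translations of twisted graphs *)

Section TwistedGraphs.
Variables (gT : finGroupType) (S : {set gT}) (sigma : gT -> gT).
Hypothesis hsigma : anti_automorphism sigma.

Lemma card_twisted_cayley x : #|[set y | twisted_cayley S sigma x y]| = #|S|.
Proof.
have [/bij_inj inj _] := hsigma.
rewrite -(card_imset S (inj_comp inj (mulgI x))).
apply: eq_card => y; rewrite inE; apply/exists_inP/imsetP.
  by case=> s sS /eqP ->; exists s.
by case=> s sS ->; exists s => /=.
Qed.

Lemma card_twisted_cayley_sum x :
  #|[set y | twisted_cayley_sum S sigma x y]| = #|S|.
Proof. exact: (card_twisted_cayley x^-1). Qed.

(** As [sigma] reverses products, [sigma (tau g * x * s) = sigma (x * s) * g]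
   for the inverse [tau] of [sigma]. *)
Lemma twisted_cayley_isotopy g : exists p q, [/\ bijective p, bijective q,
  forall x y, twisted_cayley S sigma (p x) (q y) = twisted_cayley S sigma x y &
  q 1%g = g].
Proof.
have [[tau sigmaK tauK] sigmaM] := hsigma.
exists (mulg (tau g)), (mulg^~ g); split; last exact: mul1g.
- exact: (Bijective (mulKg _) (mulKVg _)).
- exact: (Bijective (mulgK _) (mulgKV _)).
move=> x y; apply: eq_existsb => s /=; congr (_ && _).
by rewrite -mulgA [in LHS]sigmaM tauK (inj_eq (mulIg g)).
Qed.

(** The inversion of the vertex in the edge relation turns the left translation
   of the Cayley case into a right one. *)
Lemma twisted_cayley_sum_isotopy g : exists p q, [/\ bijective p, bijective q,
  forall x y,
    twisted_cayley_sum S sigma (p x) (q y) = twisted_cayley_sum S sigma x y &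
  q 1%g = g].
Proof.
have [[tau sigmaK tauK] sigmaM] := hsigma.
exists (mulg^~ (tau g)^-1%g), (mulg^~ g); split; last exact: mul1g.
- exact: (Bijective (mulgK _) (mulgKV _)).
- exact: (Bijective (mulgK _) (mulgKV _)).
move=> x y; apply: eq_existsb => s /=; congr (_ && _).
by rewrite invMg invgK -mulgA [in LHS]sigmaM tauK (inj_eq (mulIg g)).
Qed.

End TwistedGraphs.

(** * Numerical bounds *)

Section Bounds.
Variables (R : realType) (h l : R) (d : nat).
Hypotheses (h_gt0 : 0 < h) (h_le : h <= d%:R).
Hypothesis upper : h ^+ 2 <= 2 * d%:R ^+ 2 * (1 - l).
Hypothesis lower :
  h ^+ 2 <= 256 * d%:R ^+ 2 * (1 + l) \/ 2 <= d%:R * (1 + l).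

Let dR_gt0 : 0 < d%:R :> R. Proof. exact: lt_le_trans h_le. Qed.
Let i := d%:R^-1 : R.
Let rho := (h * i) ^+ 2.

Let i_gt0 : 0 < i. Proof. by rewrite invr_gt0. Qed.
Let i_le1 : i <= 1.
Proof. by rewrite invf_le1 // ler1n -(ltr0n R). Qed.
Let rho_gt0 : 0 < rho. Proof. by rewrite exprn_gt0 ?mulr_gt0. Qed.
Let rho_le1 : rho <= 1.
Proof.
by rewrite /rho /i expr_le1 ?ler_pdivrMr ?mul1r // ltW // divr_gt0.
Qed.

Let i_ge0 : 0 <= i := ltW i_gt0.
Let rho_ge0 : 0 <= rho := ltW rho_gt0.
Let iX_le1 n : i ^+ n <= 1. Proof. exact: exprn_ile1. Qed.
Let iX_ge0 n : 0 <= i ^+ n. Proof. exact: exprn_ge0. Qed.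

Let lower_cases : rho <= 256 * (1 + l) \/ 2 * i <= 1 + l.
Proof.
case: lower => le; [left|right].
  by rewrite /rho /i exprMn exprVn ler_pdivrMr ?exprn_gt0 // mulrAC.
by rewrite /i ler_pdivrMr // mulrC.
Qed.

Lemma upper_bound : l <= 1 - h ^+ 2 / (2 * d%:R ^+ 2).
Proof.
rewrite lerBrDr -lerBrDl ler_pdivrMr ?mulr_gt0 ?exprn_gt0 // mulrC; exact: upper.
Qed.

Lemma lower_bound : -1 + h ^+ 4 / (2 ^+ 12 * d%:R ^+ 8) < l.
Proof.
have -> : h ^+ 4 / (2 ^+ 12 * d%:R ^+ 8) = rho ^+ 2 * i ^+ 4 / 4096.
  by rewrite /rho /i; field; rewrite gt_eqF.
have r1 : rho ^+ 2 <= 1 by exact: exprn_ile1.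
have le_rho : rho ^+ 2 * i ^+ 4 <= rho.
  by rewrite expr2 -mulrA ger_pMr // mulr_ile1.
have le_i : rho ^+ 2 * i ^+ 4 <= i.
  by rewrite [i ^+ 4]exprS mulrCA ger_pMr // mulr_ile1 // sqr_ge0.
move: le_rho le_i; set E := rho ^+ 2 * i ^+ 4 => le_rho le_i.
have := lower_cases; move: rho_gt0 i_gt0 => r0 i0 [le|le].
  lra.
lra.
Qed.

Lemma real_root_lt k (x : R) : odd k -> x < l ^+ k -> real_root k x < l.
Proof.
move=> ko; rewrite !ltNge; apply: contraNN => le; rewrite -[X in _ <= X](real_rootK x ko).
have homo (a b : R) : 0 <= a -> a <= b -> a ^+ k <= b ^+ k.
  by move=> a0 ab; apply: lerXn2r; rewrite ?nnegrE ?(le_trans a0).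
have oddN (a : R) : (- a) ^+ k = - a ^+ k by rewrite exprNn -signr_odd ko mulN1r.
have [l0|l0] := leP 0 l; first exact: homo.
have [r0|r0] := leP 0 (real_root k x).
  apply: (@le_trans _ _ 0); last exact: exprn_ge0.
  by rewrite -(opprK l) oddN oppr_le0 exprn_ge0 // oppr_ge0 ltW.
have := homo (- real_root k x) (- l).
by rewrite !oddN !lerN2; apply=> //; rewrite oppr_ge0 ltW.
Qed.

(** Convexity of the k-th power between [1 - g] and [1], at the point
   [(1 - t) * 1 + t * (1 - g)]. *)
Lemma contraction_exp (t g : R) k : 0 <= t <= 1 -> 0 <= g <= 1 ->
  (1 - t * g) ^+ k <= 1 - t * (1 - (1 - g) ^+ k).
Proof.
move=> /andP[t0 t1] /andP[g0 g1].
elim: k => [|k IH]; first by rewrite !expr0; lra.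
have q1 : (1 - g) ^+ k <= 1 by rewrite exprn_ile1 //; lra.
have tg : 0 <= 1 - t * g by rewrite subr_ge0 mulr_ile1.
rewrite !exprS; apply: le_trans (ler_wpM2l tg IH) _.
rewrite -subr_ge0; set q := (1 - g) ^+ k in q1 *.
have -> : 1 - t * (1 - (1 - g) * q) - (1 - t * g) * (1 - t * (1 - q)) =
  t * g * ((1 - t) * (1 - q)) by ring.
by rewrite !mulr_ge0 // subr_ge0.
Qed.

(** Only [l < 0] matters, where [l ^+ k = - (- l) ^+ k] is at least
   [-1 + y / 128] or [-1 + 2 / d], with [y = 1 - (1 - g) ^+ k]. *)
Lemma lower_bound_root k : (1 <= k)%N -> odd k ->
  real_root k (-1 + (2 ^+ 12 * d%:R ^+ (8 * k))^-1 *
    (2^-1 * (1 - (1 - h ^+ 2 / (2 * d%:R ^+ 2)) ^+ k)) ^+ 4) < l.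
Proof.
move=> k1 ko; apply: real_root_lt => //.
have r0 := rho_gt0; have r1 := rho_le1; have i0 := i_gt0.
set g := h ^+ 2 / (2 * d%:R ^+ 2).
have gE : g = rho / 2 by rewrite /g /rho /i; field; rewrite gt_eqF.
have g_gt0 : 0 < g by rewrite gE; lra.
have g_le1 : g <= 1 by rewrite gE; lra.
set y := 1 - (1 - g) ^+ k.
have y_gt0 : 0 < y.
  by rewrite subr_gt0 exprn_ilt1 ?subr_ge0 ?gtrBl // -lt0n.
have y_le1 : y <= 1 by rewrite gerBl exprn_ge0 // subr_ge0.
have EE : (2 ^+ 12 * d%:R ^+ (8 * k))^-1 * (2^-1 * y) ^+ 4 =
    y ^+ 4 * i ^+ (8 * k) / 16 / 4096.
  rewrite /i exprVn; move: (d%:R ^+ _) (expf_neq0 (8 * k) (lt0r_neq0 dR_gt0)).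
  by move=> D D0; field.
have y_ge0 := ltW y_gt0.
have yX_le1 n : y ^+ n <= 1 by exact: exprn_ile1.
have E_le_y : y ^+ 4 * i ^+ (8 * k) <= y.
  by rewrite exprS -mulrA ger_pMr // mulr_ile1 ?exprn_ge0.
have E_le_i : y ^+ 4 * i ^+ (8 * k) <= i.
  rewrite -(prednK (_ : 0 < 8 * k)%N) ?muln_gt0 // [i ^+ _]exprS mulrCA ger_pMr //.
  by rewrite mulr_ile1 ?exprn_ge0.
rewrite EE; have [l0|l0] := leP 0 l.
  have := exprn_ge0 k l0; lra.
have l_geN1 : 0 <= 1 + l by case: lower_cases; lra.
have -> : l ^+ k = - (- l) ^+ k by rewrite exprNn -signr_odd ko mulN1r opprK.
have [le|le] := lower_cases.
  have : (- l) ^+ k <= (1 - 128^-1 * g) ^+ k.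
    by apply: lerXn2r; rewrite ?nnegrE; lra.
  have : (1 - 128^-1 * g) ^+ k <= 1 - 128^-1 * y.
    by apply: contraction_exp; apply/andP; split; lra.
  lra.
have : (- l) ^+ k <= - l.
  by rewrite -(prednK k1) exprS ger_pMr ?oppr_gt0 // exprn_ile1 //; lra.
lra.
Qed.

End Bounds.

(** * The main theorem *)

Theorem theorem5p1 (R : realType) (gT : finGroupType) (S : {set gT}) (d : nat)
    (hd : #|S| = d) (sigma : gT -> gT) (hsigma : anti_automorphism sigma) :
  [/\ (let e := twisted_cayley S sigma in
       let h := vertex_cheeger R e in
       graph_connected e -> undirected e -> (4 <= #|gT|)%N ->
       forall l : R, l \in nontrivial_spectrum R d e ->
         l \in `] -1 + h ^+ 4 / (2 ^+ 12 * d%:R ^+ 8),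
                  1 - h ^+ 2 / (2 * d%:R ^+ 2) ]),
      (involutive sigma ->
       let e := twisted_cayley_sum S sigma in
       let h := vertex_cheeger R e in
       graph_connected e -> undirected e -> (4 <= #|gT|)%N ->
       forall l : R, l \in nontrivial_spectrum R d e ->
         l \in `] -1 + h ^+ 4 / (2 ^+ 12 * d%:R ^+ 8),
                  1 - h ^+ 2 / (2 * d%:R ^+ 2) ]) &
      (forall k : nat, (1 <= k)%N -> odd k -> iter (2 * k) sigma =1 id ->
       let e := twisted_cayley_sum S sigma in
       let h := vertex_cheeger R e in
       graph_connected e -> undirected e -> (4 <= #|gT|)%N ->
       forall l : R, l \in nontrivial_spectrum R d e ->
         l \in `] real_root k
                    (-1 + (2 ^+ 12 * d%:R ^+ (8 * k))^-1 *
                      (2^-1 * (1 - (1 - h ^+ 2 / (2 * d%:R ^+ 2)) ^+ k)) ^+ 4),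
                  1 - h ^+ 2 / (2 * d%:R ^+ 2) ])].

Proof.
have two : (4 <= #|gT|)%N -> (2 <= #|gT|)%N by apply: leq_trans.
have cayley_iso := twisted_cayley_isotopy S hsigma.
have sum_iso := twisted_cayley_sum_isotopy S hsigma.
have cayley_reg x : #|[set y | twisted_cayley S sigma x y]| = d.
  by rewrite card_twisted_cayley.
have sum_reg x : #|[set y | twisted_cayley_sum S sigma x y]| = d.
  by rewrite card_twisted_cayley_sum.
split=> [|_|k k1 ko _] e h econn esym /two T2 l lspec.
- have [h0 hle up lo] := isotopic_spectrum T2 esym econn cayley_reg cayley_iso lspec.
  by rewrite in_itv /= lower_bound // upper_bound.
- have [h0 hle up lo] := isotopic_spectrum T2 esym econn sum_reg sum_iso lspec.
  by rewrite in_itv /= lower_bound // upper_bound.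
- have [h0 hle up lo] := isotopic_spectrum T2 esym econn sum_reg sum_iso lspec.
  by rewrite in_itv /= lower_bound_root // upper_bound.
Qed.
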